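(* Let $p\in[1,\infty]$, let $E$ and $L$ be locally convex spaces, and let $T:E\to L$ be a linear map. Then: (i) if $T$ is finite-dimensional (has finite-dimensional range) and continuous, then $T$ is $p$-convergent, coarse $p$-limited and weak$^\ast$ $p$-convergent; (ii) if $T$ is weak$^\ast$ $p$-convergent, then it is weakly $p$-convergent; the converse is true if $L$ has the Grothendieck property; (iii) if $L$ is $\infty$-quasibarrelled and $T$ is $p$-convergent, then $T$ is weakly $p$-convergent; (iv) if $L$ is $c_0$-barrelled and $T$ is $p$-convergent, then $T$ is weak$^\ast$ $p$-convergent.
   Context: All locally convex spaces are Hausdorff and over the field $\mathbb{F}\in\{\mathbb{R},\mathbb{C}\}$. $E'$ is the topological dual of $E$; $E'_{w^\ast}$ and $E'_\beta$ are $E'$ with the weak$^\ast$ topology $\sigma(E',E)$ and the strong topology $\beta(E',E)$. A sequence $\{x_n\}$ in $E$ is weakly $p$-summable if for every $\chi\in E'$, $(\langle\chi,x_n\rangle)_n\in\ell_p$ if $p<\infty$, and $(\langle\chi,x_n\rangle)_n\in c_0$ if $p=\infty$. A linear map $T:E\to L$ is: $p$-convergent if it sends weakly $p$-summable sequences of $E$ to null sequences of $L$; weakly $p$-convergent if $\lim_n\langle\eta_n,T(x_n)\rangle=0$ for every weakly null sequence $\{\eta_n\}$ in $L'_\beta$ and every weakly $p$-summable sequence $\{x_n\}$ in $E$; weak$^\ast$ $p$-convergent if the same limit holds for every weak$^\ast$ null sequence $\{\eta_n\}$ in $L'$ and every weakly $p$-summable $\{x_n\}$ in $E$; coarse $p$-limited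 if there is a neighborhood $U$ of zero in $E$ such that $T(U)$ is a coarse $p$-limited subset of $L$. A non-empty subset $A$ of $L$ is coarse $p$-limited if for every continuous linear $S:L\to\ell_p$ (or $S:L\to c_0$ if $p=\infty$) the set $S(A)$ is relatively compact. A locally convex space $L$ is: $c_0$-barrelled if every $\sigma(L',L)$-null sequence is equicontinuous; $\infty$-quasibarrelled if every weakly null sequence in the locally convex space $L'_\beta$ is equicontinuous; Grothendieck (has the Grothendieck property) if the identity map $L'_{w^\ast}\to (L'_\beta)_w$ is sequentially continuous, where $(L'_\beta)_w$ is $L'_\beta$ with its weak topology. *)

(* Defs.v *)
From HB Require Import structures.
From mathcomp Require Import all_boot all_order all_algebra complex.
From mathcomp Require Import all_classical all_reals all_analysis.

Set Implicit Arguments.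
Unset Strict Implicit.
Unset Printing Implicit Defensive.

Import Order.TTheory GRing.Theory Num.Theory.
Import numFieldNormedType.Exports.

Local Open Scope classical_set_scope.
Local Open Scope ring_scope.

Variant scalar_kind := RealScalars | ComplexScalars.

Definition scalar_field (R : realType) (k : scalar_kind) : numFieldType :=
  match k with RealScalars => R | ComplexScalars => R[i] end.

(* The norm of a numFieldType takes its values in the field itself; modulus is
   the corresponding R-valued absolute value. *)
Definition modulus (R : realType) (k : scalar_kind) : scalar_field R k -> R :=
  match k with
  | RealScalars => fun x : R => `|x|
  | ComplexScalars => fun z : R[i] => complex.Re `|z|
  end.

Definition of_real (R : realType) (k : scalar_kind) : R -> scalar_field R k :=
  match k with
  | RealScalars => id
  | ComplexScalars => fun x : R => (x%:C)%C
  end.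
Arguments of_real {R} k x.

Section ScalarTheory.
Context {R : realType} {k : scalar_kind}.
Implicit Types (a b : R) (x y : scalar_field R k).

Lemma norm_modulus x : `|x| = of_real k (modulus x).
Proof. by case: k x => //= x; rewrite normc_def. Qed.

Lemma of_realD a b : of_real k (a + b) = of_real k a + of_real k b.
Proof. by case: k => //=; rewrite rmorphD. Qed.

Lemma of_realM a b : of_real k (a * b) = of_real k a * of_real k b.
Proof. by case: k => //=; rewrite rmorphM. Qed.

Lemma of_real_le a b : (of_real k a <= of_real k b) = (a <= b).
Proof. by case: k => //=; rewrite lecR. Qed.

Lemma of_real_inj : injective (of_real k : R -> scalar_field R k).
Proof. by move=> a b ab; apply/le_anti; rewrite -!of_real_le ab lexx. Qed.

Lemma of_real0 : of_real k (0 : R) = 0.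
Proof. by case: k => //=. Qed.

Lemma modulus_ge0 x : 0 <= modulus x.
Proof. by rewrite -of_real_le -norm_modulus of_real0. Qed.

Lemma modulusD x y : modulus (x + y) <= modulus x + modulus y.
Proof. by rewrite -of_real_le of_realD -!norm_modulus ler_normD. Qed.

Lemma modulusM x y : modulus (x * y) = modulus x * modulus y.
Proof. by apply: of_real_inj; rewrite of_realM -!norm_modulus normrM. Qed.

Lemma modulus0 : modulus (0 : scalar_field R k) = 0.
Proof. by apply: of_real_inj; rewrite -norm_modulus normr0 of_real0. Qed.

Lemma modulus0_eq0 x : modulus x = 0 -> x = 0.
Proof. by move=> x0; apply/normr0_eq0; rewrite norm_modulus x0 of_real0. Qed.

End ScalarTheory.

Section EllpNorm.
Context {R : realType} {k : scalar_kind}.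
Local Notation K := (scalar_field R k).
Implicit Types (p : \bar R) (r : R) (x y : nat -> K^o).

(* l_p for finite p, c_0 for p = +oo; only meant for 1 <= p. *)
Definition in_ellp p x : Prop :=
  if p is r%:E then (\sum_(n <oo) (modulus (x n) `^ r)%:E < +oo)%E
  else x n @[n --> \oo] --> (0 : K^o).

Definition ellp_norm p x : R :=
  if p is r%:E then fine (\sum_(n <oo) (modulus (x n) `^ r)%:E)%E `^ r^-1
  else sup (range (fun n => modulus (x n))).

Definition ellp_pred p : {pred nat -> K^o} := fun x => `[< in_ellp p x >].

Let series_ge0 r x : (0 <= \sum_(n <oo) (modulus (x n) `^ r)%:E)%E.
Proof. by apply: nneseries_ge0 => n _ _; rewrite lee_fin powR_ge0. Qed.

Let LnormE r x : 1 <= r ->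
  'N[counting]_(r%:E)[EFin \o (fun n => modulus (x n))]%E =
  ((\sum_(n <oo) (modulus (x n) `^ r)%:E) `^ r^-1)%E.
Proof.
move=> r1; rewrite Lnorm_counting ?(lt_le_trans ltr01)//; congr (_ `^ _)%E.
by apply: eq_eseriesr => n _; rewrite /= ger0_norm ?modulus_ge0.
Qed.

Let ellp_norm_Lnorm r x : 1 <= r -> in_ellp r%:E x ->
  (ellp_norm r%:E x)%:E =
  'N[counting]_(r%:E)[EFin \o (fun n => modulus (x n))]%E.
Proof.
by move=> r1 xr; rewrite LnormE//= -poweR_EFin fineK ?ge0_fin_numE.
Qed.

Let in_ellp_Lnorm r x : 1 <= r ->
  in_ellp r%:E x <->
  ('N[counting]_(r%:E)[EFin \o (fun n => modulus (x n))] < +oo)%E.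
Proof.
move=> r1; have r0 : 0 < r by apply: lt_le_trans r1.
rewrite LnormE//; split=> [h|h]; first exact: poweR_lty.
by apply: (@lty_poweRy _ _ r^-1) h; rewrite invr_neq0// gt_eqF.
Qed.

Let LnormD r x y : 1 <= r ->
  ('N[counting]_(r%:E)[EFin \o (fun n => modulus (x n + y n))] <=
   'N[counting]_(r%:E)[EFin \o (fun n => modulus (x n))] +
   'N[counting]_(r%:E)[EFin \o (fun n => modulus (y n))])%E.
Proof.
move=> r1; have r0 : 0 < r by apply: lt_le_trans r1.
have := @eminkowski _ _ R counting (fun n => modulus (x n))
  (fun n => modulus (y n)) r%:E (fun _ _ _ => I) (fun _ _ _ => I) r1.
apply: le_trans; rewrite !Lnorm_counting//.
rewrite gt0_ler_poweR// ?invr_ge0 ?(ltW r0)//.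
- by rewrite in_itv/= leey andbT nneseries_ge0// => n _ _; rewrite poweR_ge0.
- by rewrite in_itv/= leey andbT nneseries_ge0// => n _ _; rewrite poweR_ge0.
apply: lee_nneseries => [n _|n _]; first by rewrite poweR_ge0.
rewrite /= lee_fin !ger0_norm ?addr_ge0 ?modulus_ge0//.
by rewrite ge0_ler_powR ?nnegrE ?addr_ge0 ?modulus_ge0 ?modulusD// ltW.
Qed.

Let seriesZ r (a : K) x : 0 < r ->
  (\sum_(n <oo) (modulus (a * x n) `^ r)%:E =
   (modulus a `^ r)%:E * \sum_(n <oo) (modulus (x n) `^ r)%:E)%E.
Proof.
move=> r0; rewrite -nneseriesZl//; last by move=> n _; rewrite lee_fin powR_ge0.
by apply: eq_eseriesr => n _; rewrite modulusM powRM ?modulus_ge0// EFinM.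
Qed.

Lemma has_sup_c0 x : x n @[n --> \oo] --> (0 : K^o) ->
  has_sup (range (fun n => modulus (x n))).
Proof.
move=> x0; split; first by exists (modulus (x 0%N)), 0%N.
have [M [Mreal hM]] : bounded_fun x.
  by apply: cvg_seq_bounded; apply/cvg_ex; exists (0 : K^o).
have xM n : `|x n| <= M + 1 by apply: hM => //; rewrite ltrDl.
exists (modulus (M + 1 : K)) => _ [n _ <-].
rewrite -(@of_real_le _ k) -!norm_modulus.
by rewrite [leRHS]ger0_norm ?(le_trans (normr_ge0 (x 0%N)) (xM 0%N)).
Qed.

Lemma ellp_pred_submod p : (1 <= p)%E -> submod_closed (ellp_pred p).
Proof.
case: p => [r|_|//].
  rewrite lee_fin => r1.
  have r0 : 0 < r by apply: lt_le_trans r1.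
  split=> [|a x y /asboolP xr /asboolP yr]; apply/asboolP.
    rewrite /in_ellp eseries0// => n _ _.
    by rewrite modulus0 powR0// gt_eqF.
  apply/in_ellp_Lnorm => //; apply: le_lt_trans (LnormD (a *: x) y r1) _.
  apply: lte_add_pinfty; apply/in_ellp_Lnorm => //.
  by rewrite /in_ellp seriesZ// lte_mul_pinfty// lee_fin powR_ge0.
split=> [|a x y /asboolP x0 /asboolP y0]; apply/asboolP.
  exact: cvg_cst.
rewrite /in_ellp (_ : 0 = a *: (0 : K^o) + 0); last by rewrite scaler0 addr0.
by apply: cvgD => //; apply: cvgZl_tmp.
Qed.

Lemma ellp_normD p x y : (1 <= p)%E -> in_ellp p x -> in_ellp p y ->
  ellp_norm p (x + y) <= ellp_norm p x + ellp_norm p y.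
Proof.
case: p => [r r1|_|//] xp yp.
  move: r1; rewrite lee_fin => r1.
  have xyp : in_ellp r%:E (x + y).
    apply/asboolP; rewrite -[x]scale1r.
    have [_ h] := @ellp_pred_submod r%:E r1.
    by apply: (h 1 x y); apply/asboolP.
  have := @LnormD r x y r1.
  rewrite -(ellp_norm_Lnorm r1 xp) -(ellp_norm_Lnorm r1 yp).
  by rewrite -(ellp_norm_Lnorm r1 xyp) -EFinD lee_fin.
apply: ge_sup; first by exists (modulus (x 0%N + y 0%N)), 0%N.
move=> _ [n _ <-]; apply: le_trans (modulusD _ _) _; apply: lerD.
- by apply: ub_le_sup; [exact: (has_sup_c0 xp).2|exists n].
- by apply: ub_le_sup; [exact: (has_sup_c0 yp).2|exists n].
Qed.

Lemma ellp_normZ p (a : K) x : (1 <= p)%E -> in_ellp p x ->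
  ellp_norm p (a *: x) = modulus a * ellp_norm p x.
Proof.
case: p => [r r1|_|//] xp.
  move: r1; rewrite lee_fin => r1.
  have r0 : 0 < r by apply: lt_le_trans r1.
  rewrite /ellp_norm seriesZ// fineM ?ge0_fin_numE ?ltry ?lee_fin ?powR_ge0//.
  rewrite powRM ?powR_ge0 ?fine_ge0// -powRrM mulfV ?gt_eqF// powRr1//.
  exact: modulus_ge0.
have le_normZ (b : K) y : in_ellp +oo%E y ->
    ellp_norm +oo%E (b *: y) <= modulus b * ellp_norm +oo%E y.
  move=> yp; apply: ge_sup; first by exists (modulus (b * y 0%N)), 0%N.
  move=> _ [n _ <-]; rewrite modulusM ler_wpM2l ?modulus_ge0//.
  by apply: ub_le_sup; [exact: (has_sup_c0 yp).2|exists n].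
apply/le_anti/andP; split; first exact: le_normZ.
have [->|a0] := eqVneq a 0.
  rewrite modulus0 mul0r; apply: le_trans (modulus_ge0 ((0 *: x) 0%N)) _.
  apply: ub_le_sup; last by exists 0%N.
  exists 0 => _ [n _ <-].
  by have -> : (0 *: x) n = 0 := mul0r (x n); rewrite modulus0.
have am : 0 < modulus a.
  rewrite lt_neqAle modulus_ge0 andbT eq_sym.
  by apply: contra_neq a0 => /modulus0_eq0.
have axp : in_ellp +oo%E (a *: x).
  have [z h] := @ellp_pred_submod +oo%E (leey 1%E).
  apply/asboolP; rewrite -[_ *: _]addr0.
  by apply: (h a x 0) => //; apply/asboolP.
have := le_normZ a^-1 _ axp; rewrite scalerA mulVf// scale1r.
move=> /(ler_wpM2l (ltW am)); rewrite mulrA -modulusM mulfV//.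
suff -> : modulus (1 : K) = 1 by rewrite mul1r.
by apply: (mulfI (lt0r_neq0 am)); rewrite -modulusM !mulr1.
Qed.

Lemma ellp_norm0_eq0 p x : (1 <= p)%E -> in_ellp p x ->
  ellp_norm p x = 0 -> x = 0.
Proof.
case: p => [r r1|_|//] xp.
  move: r1; rewrite lee_fin => r1.
  have r0 : 0 < r by apply: lt_le_trans r1.
  move=> /powR_eq0_eq0 s0; apply/funext => n; apply: modulus0_eq0.
  apply: (@powR_eq0_eq0 _ _ r); apply/le_anti; rewrite powR_ge0 andbT.
  rewrite -s0 -lee_fin fineK ?ge0_fin_numE//.
  apply: le_trans (nneseries_lim_ge n.+1 _) => [|? _ _].
    rewrite big_nat_recr//= leeDr// sume_ge0// => i _.
    by rewrite lee_fin powR_ge0.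
  by rewrite lee_fin powR_ge0.
move=> s0; apply/funext => n; apply: modulus0_eq0.
apply/le_anti; rewrite modulus_ge0 andbT -s0.
by apply: ub_le_sup; [exact: (has_sup_c0 xp).2|exists n].
Qed.

End EllpNorm.

Record ellp (R : realType) (k : scalar_kind) (p : \bar R) (p1 : (1 <= p)%E) :=
  Ellp {
    ellp_val :> nat -> (scalar_field R k)^o;
    _ : ellp_val \in ellp_pred p }.
Arguments ellp {R} k {p} p1.

Section EllpSpace.
Context (R : realType) (k : scalar_kind) (p : \bar R) (p1 : (1 <= p)%E).
Local Notation K := (scalar_field R k).
Local Notation V := (ellp k p1).

HB.instance Definition _ := [isSub for @ellp_val R k p p1].
HB.instance Definition _ := [Choice of V by <:].
HB.instance Definition _ :=
  GRing.isSubmodClosed.Build K (nat -> K^o) (ellp_pred p) (ellp_pred_submod p1).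
HB.instance Definition _ := [SubChoice_isSubLmodule of V by <:].

Let nrm (x : V) : K := of_real k (ellp_norm p x).

Let in_ellp_val (x : V) : in_ellp p x.
Proof. exact/asboolP/(valP x). Qed.

Let nrmD (x y : V) : nrm (x + y) <= nrm x + nrm y.
Proof.
rewrite /nrm -of_realD of_real_le.
exact: (ellp_normD p1 (in_ellp_val x) (in_ellp_val y)).
Qed.

Let nrmZ (a : K) (x : V) : nrm (a *: x) = `|a| * nrm x.
Proof.
rewrite norm_modulus /nrm -of_realM; congr of_real.
exact: (ellp_normZ a p1 (in_ellp_val x)).
Qed.

Let nrm0_eq0 (x : V) : nrm x = 0 -> x = 0.
Proof.
rewrite /nrm -(@of_real0 R k) => /of_real_inj x0.
by apply: val_inj; exact: ellp_norm0_eq0 p1 (in_ellp_val x) x0.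
Qed.

HB.instance Definition _ := Lmodule_isNormed.Build K V nrmD nrmZ nrm0_eq0.

End EllpSpace.

Lemma ellp_normE (R : realType) (k : scalar_kind) (p : \bar R)
    (p1 : (1 <= p)%E) (x : ellp k p1) :
  `|x| = of_real k (ellp_norm p x).
Proof. by []. Qed.

Section Dual.
Context {K : numFieldType} (E : tvsType K).

Definition dual_pred : {pred E -> K^o} :=
  fun f => `[< linear f /\ continuous f >].

Record tvs_dual := Dual { dual_val :> E -> K^o; _ : dual_val \in dual_pred }.

HB.instance Definition _ := [isSub for dual_val].
HB.instance Definition _ := [Choice of tvs_dual by <:].

Lemma dual_pred_submod : submod_closed dual_pred.
Proof.
split=> [|a f g /asboolP[lf cf] /asboolP[lg cg]]; apply/asboolP.
  split=> [b u v|x]; last exact: cvg_cst.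
  by change (0 = b *: (0 : K^o) + 0); rewrite scaler0 addr0.
split=> [b u v|x].
  rewrite !fctE lf lg !scalerDr !scalerA mulrC -!addrA; congr (_ + _).
  by rewrite addrCA.
by apply: cvgD; [apply: cvgZl_tmp; exact: cf|exact: cg].
Qed.

HB.instance Definition _ :=
  GRing.isSubmodClosed.Build K (E -> K^o) dual_pred dual_pred_submod.
HB.instance Definition _ := [SubChoice_isSubLmodule of tvs_dual by <:].

Lemma dual_linear (f : tvs_dual) : linear f.
Proof. by case: f => f /= /asboolP[]. Qed.

Lemma dual0 (f : tvs_dual) : f 0 = 0.
Proof.
have := dual_linear f 1 0 0; rewrite !scale1r addr0 => /esym/eqP.
by rewrite -subr_eq0 addrK => /eqP.
Qed.

Lemma dual_continuous (f : tvs_dual) : continuous f.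
Proof. by case: f => f /= /asboolP[]. Qed.

(* sigma(E, E') *)
Definition weak_space : Type := E.
HB.instance Definition _ := GRing.Lmodule.on weak_space.
HB.instance Definition _ := Topological.copy weak_space
  (initial_topology (fun x : E => (fun f => f x) : {ptws tvs_dual -> K^o})).

(* sigma(E', E) *)
Definition weak_star_dual : Type := tvs_dual.
HB.instance Definition _ := GRing.Lmodule.on weak_star_dual.
HB.instance Definition _ := Topological.copy weak_star_dual
  (initial_topology (fun f : tvs_dual => (f : E -> K^o) : {ptws E -> K^o})).

Definition tvs_bounded (A : set E) :=
  forall U, nbhs (0 : E) U ->
    exists2 r : K, 0 < r & forall t : K, r <= `|t| -> A `<=` *:%R t @` U.

(* beta(E', E): uniform convergence on the bounded subsets of E *)
Definition strong_dual : Type := tvs_dual.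
HB.instance Definition _ := GRing.Lmodule.on strong_dual.
HB.instance Definition _ := Uniform.copy strong_dual (initial_topology
  (fun f : tvs_dual => (f : E -> K^o) : {family tvs_bounded, E -> K^o})).
End Dual.

Section StrongDualTvs.
Context {K : numFieldType} (E : tvsType K).
Implicit Types (f g : strong_dual E) (A : set E) (e : K).

Let D := strong_dual E.

Lemma tvs_boundedU A B : tvs_bounded A -> tvs_bounded B ->
  tvs_bounded (A `|` B).
Proof.
move=> bA bB U U0; have [r r0 hr] := bA U U0; have [s s0 hs] := bB U U0.
exists (r + s); first exact: addr_gt0.
move=> t rst x [Ax|Bx].
  by apply: (hr t) => //; apply: le_trans rst; rewrite lerDl ltW.
by apply: (hs t) => //; apply: le_trans rst; rewrite lerDr ltW.
Qed.

Lemma tvs_bounded_dual (f : tvs_dual E) A : tvs_bounded A ->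
  exists2 M : K, 0 < M & forall x, A x -> `|f x| <= M.
Proof.
move=> bA.
have f0 := dual0 f.
have fZ (t : K) x : f (t *: x) = t * f x.
  by have := dual_linear f t x 0; rewrite f0 !addr0.
have /bA[r r0 hr] : nbhs (0 : E) [set x | `|f x| < 1].
  have cf : f x @[x --> (0 : E)] --> (f 0 : K^o) := @dual_continuous _ _ f 0.
  by have /cvgr_dist_lt/(_ 1 ltr01) := cf; apply: filterS => x /=;
    rewrite f0 sub0r normrN.
have rr : r <= `|r| by rewrite ger0_norm// ltW.
exists r => // x Ax; have [y /= fy <-] := hr r rr x Ax.
by rewrite fZ normrM ger0_norm ?(ltW r0)// ler_piMr// ltW.
Qed.

Let sball f A e : set D := [set g | forall x, A x -> `|f x - g x| < e].

Lemma strong_dual_nbhs f A e : tvs_bounded A -> 0 < e ->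
  nbhs f [set g : strong_dual E | forall x, A x -> `|f x - g x| < e].
Proof.
move=> bA e0.
have ent : entourage [set xy : K^o * K^o | ball xy.1 e xy.2].
  by rewrite -entourage_ballE; exists e.
have /= := @fam_nbhs E K^o (@tvs_bounded K E) A _ (f : E -> K^o) ent bA.
move=> /(@initial_continuous _ _ (fun f : tvs_dual E => (f : E -> K^o) :
  {family @tvs_bounded K E, E -> K^o})).
apply: (@filterS (strong_dual E) (nbhs f) _) => g h x Ax.
by have := h x Ax; rewrite /= -ball_normE.
Qed.

Lemma strong_dual_nbhsE f (U : set (strong_dual E)) : nbhs f U ->
  exists A e, [/\ tvs_bounded A, 0 < e &
    [set g : strong_dual E | forall x, A x -> `|f x - g x| < e] `<=` U].
Proof.
pose F : set_system (E -> K^o) := filter_from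
  [set Ae : set E * K | tvs_bounded Ae.1 /\ 0 < Ae.2]
  (fun Ae => [set g | forall x, Ae.1 x -> `|f x - g x| < Ae.2]).
have FF : Filter F.
  apply: filter_from_filter.
    by exists (set0, 1); split=> //= V V0; exists 1 => // t _ x [].
  move=> [A e] [B e'] [/= bA e0] [/= bB e'0].
  have cmp : (e >=< e')%O by apply: real_comparable; apply: gtr0_real.
  exists (A `|` B, Order.min e e') => /=.
    split; first exact: tvs_boundedU.
    by rewrite comparable_lt_min// e0.
  move=> g h; split=> x Ax.
    by have := h x (or_introl Ax); rewrite comparable_lt_min// => /andP[].
  by have := h x (or_intror Ax); rewrite comparable_lt_min// => /andP[].
have Ff : {family (@tvs_bounded K E), F --> (f : E -> K^o)}.
  apply/fam_cvgP => A bA V /uniform_nbhs[P [+ PV]].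
  rewrite -entourage_ballE => -[e /= e0 eP].
  exists (A, e); first by split.
  move=> g h; apply: PV => x Ax; apply: eP => /=.
  by rewrite -ball_normE /=; exact: h.
rewrite nbhsE => -[V [[C oC <-] Cf] VU].
have : nbhs (f : {family @tvs_bounded K E, E -> K^o}) C.
  by exact: open_nbhs_nbhs.
move=> /Ff[[A e] [/= bA e0] h].
by exists A, e; split => // g hg; apply: VU; exact: h.
Qed.

Let add_cont : continuous (fun x : D * D => x.1 + x.2).
Proof.
move=> [f g] /= U /strong_dual_nbhsE[A [e [bA e0 eU]]].
have e20 : 0 < e / 2 by rewrite divr_gt0.
exists (sball f A (e / 2), sball g A (e / 2)).
  by split; exact: strong_dual_nbhs.
move=> [f' g'] /= [hf hg]; apply: eU => x Ax.
change (`|(f x + g x) - (f' x + g' x)| < e).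
rewrite opprD addrACA (splitr e) (le_lt_trans (ler_normD _ _))//.
by rewrite ltrD ?hf ?hg.
Qed.

Let scale_cont : continuous (fun z : K^o * D => z.1 *: z.2).
Proof.
move=> [a f] /= U /strong_dual_nbhsE[A [e [bA e0 eU]]].
have [M M0 hM] := tvs_bounded_dual f bA.
have a0 : 0 < `|a| + 1 by rewrite ltr_wpDl.
pose d := e / 2 / (M + e).
have d0 : 0 < d by rewrite !divr_gt0// addr_gt0.
have d1 : d <= 1.
  rewrite /d ler_pdivrMr ?addr_gt0// mul1r.
  rewrite (@le_trans _ _ e)// ?lerDr ?(ltW M0)//.
  by rewrite ler_pdivrMr// ler_peMr ?(ltW e0)// ler1n.
pose e' := e / 2 / (`|a| + 1).
have e'0 : 0 < e' by rewrite !divr_gt0.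
exists (ball (a : K^o) d, sball f A e').
  by split; [exact: nbhsx_ballx|exact: strong_dual_nbhs].
move=> [b g] /= [+ hg]; rewrite -ball_normE /= => ab; apply: eU => x Ax.
change (`|a * f x - b * g x| < e).
have -> : a * f x - b * g x = (a - b) * f x + b * (f x - g x).
  by rewrite mulrBl mulrBr addrA subrK.
rewrite (splitr e) (le_lt_trans (ler_normD _ _))// !normrM ltrD//.
  apply: (@le_lt_trans _ _ (d * M)).
    by rewrite ler_pM// ?hM// ltW.
  rewrite /d -mulrA -[ltRHS]mulr1 ltr_pM2l ?divr_gt0//.
  by rewrite mulrC ltr_pdivrMr ?addr_gt0// mul1r ltrDl.
have hb : `|b| <= `|a| + 1.
  rewrite -lerBlDl (le_trans _ d1)// (le_trans _ (ltW ab))//.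
  by rewrite distrC lerB_dist.
apply: (@le_lt_trans _ _ ((`|a| + 1) * `|f x - g x|)).
  by rewrite ler_wpM2r.
by have := hg x Ax; rewrite /e' ltr_pdivlMr// mulrC.
Qed.

Let loc_convex : exists2 B : set_system D,
  (forall b, b \in B -> convex_set b) & basis B.
Proof.
exists [set V : set D | open V /\ convex_set V].
  by move=> V; rewrite inE => -[].
split; first by move=> V [].
move=> f U /strong_dual_nbhsE[A [e [bA e0 eU]]].
pose V : set D := [set g | exists e', [/\ 0 <= e', e' < e &
  forall x, A x -> `|f x - g x| <= e']].
exists V; last first.
  by move=> g [e' [_ e'e h]]; apply: eU => x /h /le_lt_trans; apply.
split; last by exists 0; split=> // x _; rewrite subrr normr0.
split.
  rewrite openE => g [e' [e'0 e'e h]].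
  have d0 : 0 < (e - e') / 2 by rewrite divr_gt0// subr_gt0.
  have := @strong_dual_nbhs g A _ bA d0; apply: filterS => g' h'.
  exists (e' + (e - e') / 2); split.
  - by rewrite addr_ge0// ltW.
  - rewrite -ltrBrDl ltr_pdivrMr// ltr_pMr ?subr_gt0//.
    by rewrite ltr1n.
  - move=> x Ax; rewrite -(subrK (g x) (f x)) -addrA.
    by rewrite (le_trans (ler_normD _ _))// lerD ?h ?(ltW (h' _ Ax)).
apply/convex_setW => g1 g2.
rewrite !inE => -[e1 [e10 e1e h1]] [e2 [e20 e2e h2]] l l0 l1; rewrite inE.
have l1' : 0 < 1 - l%:num by rewrite subr_gt0.
have ll : l%:num + (1 - l%:num) = 1 by rewrite addrCA subrr addr0.
exists (l%:num * e1 + (1 - l%:num) * e2); split.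
- by rewrite addr_ge0// mulr_ge0// ltW.
- have -> : e = l%:num * e + (1 - l%:num) * e by rewrite -mulrDl ll mul1r.
  by rewrite ltrD// ltr_pM2l.
- move=> x Ax.
  change (`|f x - (l%:num * g1 x + (1 - l%:num) * g2 x)| <=
    l%:num * e1 + (1 - l%:num) * e2).
  have -> : f x - (l%:num * g1 x + (1 - l%:num) * g2 x) =
    l%:num * (f x - g1 x) + (1 - l%:num) * (f x - g2 x).
    by rewrite !mulrBr addrACA -mulrDl ll mul1r opprD.
  rewrite (le_trans (ler_normD _ _))// !normrM (gtr0_norm l0) (gtr0_norm l1').
  by rewrite lerD// ler_wpM2l ?(ltW l0) ?(ltW l1') ?h1 ?h2.
Qed.

HB.instance Definition _ :=
  PreTopologicalNmodule_isTopologicalNmodule.Build (strong_dual E) add_cont.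
HB.instance Definition _ :=
  TopologicalNmodule_isTopologicalLmodule.Build K (strong_dual E) scale_cont.
HB.instance Definition _ :=
  Uniform_isTvs.Build K (strong_dual E) loc_convex.

End StrongDualTvs.

Definition sequentially_continuous (X Y : topologicalType) (f : X -> Y) :=
  forall (u : nat -> X) (l : X), u @ \oo --> l -> f (u n) @[n --> \oo] --> f l.

Section LocallyConvex.
Context {K : numFieldType}.
Implicit Types E L : tvsType K.

Definition weak_null E (x : nat -> E) :=
  (x : nat -> weak_space E) @ \oo --> (0 : weak_space E).

Definition weak_star_null E (eta : nat -> tvs_dual E) :=
  (eta : nat -> weak_star_dual E) @ \oo --> (0 : weak_star_dual E).

Definition finite_dimensional_range E L (T : E -> L) :=
  exists (n : nat) (v : 'I_n -> L),
    forall x, exists c : 'I_n -> K, T x = \sum_(i < n) c i *: v i.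

Definition c0_barrelled L :=
  forall eta : nat -> tvs_dual L, weak_star_null eta ->
    equicontinuous [set: nat] (fun n => eta n : L -> K^o).

Definition infty_quasibarrelled L :=
  forall eta : nat -> strong_dual L, weak_null eta ->
    equicontinuous [set: nat] (fun n => eta n : L -> K^o).

Definition grothendieck L :=
  sequentially_continuous
    (fun eta : weak_star_dual L => (eta : weak_space (strong_dual L))).

End LocallyConvex.

Section Operators.
Context {R : realType} {k : scalar_kind}.
Local Notation K := (scalar_field R k).
Implicit Types (p : \bar R) (E L : tvsType K).

Definition weakly_summable p E (x : nat -> E) :=
  forall chi : tvs_dual E, in_ellp p (fun n => chi (x n)).

Definition p_convergent p E L (T : {linear E -> L}) :=
  forall x : nat -> E, weakly_summable p x ->
    T (x n) @[n --> \oo] --> (0 : L).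

Definition weakly_p_convergent p E L (T : {linear E -> L}) :=
  forall (eta : nat -> strong_dual L) (x : nat -> E),
    weak_null eta -> weakly_summable p x ->
    eta n (T (x n)) @[n --> \oo] --> (0 : K^o).

Definition weak_star_p_convergent p E L (T : {linear E -> L}) :=
  forall (eta : nat -> tvs_dual L) (x : nat -> E),
    weak_star_null eta -> weakly_summable p x ->
    eta n (T (x n)) @[n --> \oo] --> (0 : K^o).

Definition coarse_p_limited_set p (p1 : (1 <= p)%E) L (A : set L) :=
  A !=set0 /\
  forall S : {linear L -> ellp k p1}, continuous S -> precompact (S @` A).

Definition coarse_p_limited p (p1 : (1 <= p)%E) E L (T : {linear E -> L}) :=
  exists2 U : set E, nbhs 0 U & coarse_p_limited_set p1 (T @` U).

End Operators.

Section Characterizations.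
Context {K : numFieldType}.
Implicit Types E L : tvsType K.

Let cvg_initial_ptws (S : choiceType) (I : topologicalType) (h : S -> I -> K^o)
    (u : nat -> S) (l : S) :
  (u : nat -> initial_topology (h : S -> {ptws I -> K^o})) @ \oo -->
    (l : initial_topology (h : S -> {ptws I -> K^o})) <->
  forall i, h (u n) i @[n --> \oo] --> h l i.
Proof.
have ptwsE : {ptws, (fun n => h (u n)) @ \oo --> h l} <->
    forall i, h (u n) i @[n --> \oo] --> h l i.
  exact: (@pointwise_cvgP I K^o (h (u n) @[n --> \oo]) (h l)).
split=> [ul|/ptwsE hul].
  apply/ptwsE; apply: (@cvg_comp _ _ _ u h _ _ _ ul).
  exact: (@initial_continuous _ {ptws I -> K^o} h).
move=> U; rewrite nbhsE => -[V [[C oC <-] Cl] VU].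
have : nbhs (h l : {ptws I -> K^o}) C by exact: open_nbhs_nbhs.
by move=> /hul hC; apply: (@filterS nat \oo _ (fun n => C (h (u n)))) hC
  => n; exact: VU.
Qed.

Lemma weak_nullP E (x : nat -> E) :
  weak_null x <-> forall chi : tvs_dual E, chi (x n) @[n --> \oo] --> (0 : K^o).
Proof.
have h := @cvg_initial_ptws E (strong_dual E) (fun x chi => chi x) x 0.
split=> [/h xh chi|xh]; first by rewrite -(dual0 chi); exact: xh.
by apply/h => chi; rewrite dual0; exact: xh.
Qed.

Lemma weak_star_nullP E (eta : nat -> tvs_dual E) :
  weak_star_null eta <-> forall x : E, eta n x @[n --> \oo] --> (0 : K^o).
Proof. exact: (@cvg_initial_ptws (tvs_dual E) E (fun f => f)). Qed.
End Characterizations.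

(* Main.v *)
Require Import Defs.
From HB Require Import structures.
From mathcomp Require Import all_boot all_order all_algebra complex.
From mathcomp Require Import all_classical all_reals all_analysis.

Import Order.TTheory GRing.Theory Num.Theory.
Import numFieldNormedType.Exports.

Local Open Scope classical_set_scope.
Local Open Scope ring_scope.

(** Everything rests on two observations.

    Operators of finite rank.  Let [T] be continuous with finite-dimensional
    range in a Hausdorff space.  Choosing a basis [v] of the range gives
    [T x = \sum_i f i x *: v i], and the point is that the coordinates [f i]
    are continuous functionals ([finite_rank_decomposition]).  This is the
    uniqueness of the Hausdorff vector topology in finite dimension, proved
    here by the classical compactness argument ([coord_bounded]): combinations
    of [v] having one coordinate equal to 1 and all the others in the unit ball
    form compact sets that miss 0, so a neighborhood of 0 misses them, and
    rescaling by the largest coordinate turns this into a bound on the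
    coordinates of all vectors near 0.  Once the [f i] are continuous, a weakly
    p-summable sequence has coordinates [f i (x n)] in l_p, hence null, which
    yields both convergence statements; and the neighborhood
    [{x | |f i x| <= 1}] of 0 is mapped by any [S \o T] into the combinations of
    the [S (v i)] with coefficients in the unit ball, a relatively compact set.

    Null sequences of functionals.  A weakly null sequence of the strong dual is
    weak-star null, because evaluation at a point is a continuous functional on
    the strong dual ([strong_dual_eval_continuous]); the Grothendieck property
    is the converse implication.  Under the barrelledness assumptions a null
    sequence of functionals is equicontinuous, and an equicontinuous sequence
    tends to 0 along every null sequence ([equicontinuous_null_cvg]). *)

(** * Local compactness of the scalars *)

Lemma real_complex_continuous (R : realType) :
  continuous (fun x : R => (x%:C)%C : R[i]^o).
Proof.
move=> x; apply/cvgrPdist_lt => e e0.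
(* The order of R[i] forces a positive e to be real. *)
have -> : e = ((complex.Re e)%:C)%C.
  by case: e e0 => a b; rewrite ltcE /= => /andP[/eqP -> _].
have re0 : 0 < complex.Re e by move: e0; rewrite ltcE => /andP[].
near=> y.
rewrite -rmorphB normc_def /= expr0n addr0 sqrtr_sqr ltcR.
by near: y; exact: cvgr_dist_lt.
Unshelve. all: by end_near. Qed.

(** In the complex case the disc lies in the square [-1, 1] + i[-1, 1], a
    continuous image of a product of compact segments. *)
Lemma scalar_unit_ball_precompact (R : realType) (k : scalar_kind) :
  precompact [set a : (scalar_field R k)^o | `|a| <= 1].
Proof.
case: k => /=.
  apply: (@precompact_subset R^o _ `[-1, 1]%classic).
    by move=> a /=; rewrite in_itv/= ler_norml.
  by apply: compact_precompact; [exact: norm_hausdorff|exact: segment_compact].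
pose f (x : R * R) : R[i]^o := (x.1%:C + 'i * x.2%:C)%C.
have cf : continuous f.
  move=> x; apply: cvgD.
    apply: (@cvg_comp _ _ _ fst (fun x : R => (x%:C)%C : R[i]^o)).
      exact: cvg_fst.
    exact: real_complex_continuous.
  apply: cvgMl_tmp.
  apply: (@cvg_comp _ _ _ snd (fun x : R => (x%:C)%C : R[i]^o)).
    exact: cvg_snd.
  exact: real_complex_continuous.
apply: (@precompact_subset R[i]^o _ (f @` (`[-1, 1] `*` `[-1, 1]))%classic).
  move=> a /= a1; exists (complex.Re a, complex.Im a); last first.
    by rewrite /f/= -complexE.
  split=> /=; rewrite in_itv/= -ler_norml -lecR.
    exact: le_trans (normc_ge_Re a) a1.
  (* Im a = - Re (i a) reduces the bound on Im to the one on Re. *)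
  have -> : complex.Im a = - complex.Re ('i%C * a).
    by case: (a) => u v /=; rewrite mul0r mul1r sub0r opprK.
  rewrite normrN (le_trans (normc_ge_Re _))// normrM.
  by rewrite normc_def/= expr0n add0r expr1n sqrtr1 mul1r.
apply: compact_precompact; first exact: norm_hausdorff.
apply: continuous_compact; first exact: continuous_subspaceT.
by apply: compact_setX; exact: segment_compact.
Qed.

(** * Neighborhoods of zero and linear combinations *)

Section LinearCombinations.
Context {K : numFieldType}.
Implicit Types L : tvsType K.

(** Continuity of scaling at [(0, y)] : neighborhoods of 0 absorb points,
    locally uniformly. *)
Lemma nbhs0_absorb {L} {U : set L} (y : L) : nbhs 0 U ->
  exists2 r : K, 0 < r &
    \forall w \near y, forall t : K, r <= `|t| -> U (t^-1 *: w).
Proof.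
move=> U0; have := @scale_continuous _ L (0, y) U.
rewrite /= scale0r => /(_ U0)[[D W] /= [/nbhs_ballP[d /= d0 dD] W0] DW].
(* 1/d would only bound |t^-1| by d, while the ball is open. *)
exists (2 / d); first by rewrite divr_gt0.
apply: filterS W0 => w Ww t dt.
have t0 : 0 < `|t| by apply: lt_le_trans dt; rewrite divr_gt0.
apply: (DW (t^-1, w)); split=> //; apply: dD.
rewrite -ball_normE /= sub0r normrN normfV invf_plt ?posrE//.
by apply: lt_le_trans dt; rewrite -[ltLHS]mul1r ltr_pM2r ?invr_gt0// ltr1n.
Qed.

Lemma tvs_bounded1 {L} (y : L) : tvs_bounded [set y].
Proof.
move=> U /(nbhs0_absorb y)[r r0 /nbhs_singleton rU]; exists r => // t rt _ ->.
exists (t^-1 *: y); first exact: rU.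
rewrite scalerA divff ?scale1r// -normr_gt0.
exact: lt_le_trans rt.
Qed.

Lemma cvg_lincomb {T : Type} {F : set_system T} {FF : Filter F} {L n}
    (v : 'I_n -> L) (c : 'I_n -> T -> K^o) :
  (forall i, c i x @[x --> F] --> (0 : K^o)) ->
  (\sum_(i < n) c i x *: v i) @[x --> F] --> (0 : L).
Proof.
move=> c0.
suff : (\sum_(i < n) c i x *: v i) @[x --> F] --> \sum_(i < n) (0 : L).
  by rewrite big1_eq.
apply: (@cvg_big L _ +%R 0 predT (@add_continuous L) T F _
  (fun i x => c i x *: v i) (fun=> 0)).
move=> i _; rewrite -(scale0r (v i)).
apply: continuous2_cvg (c0 i) (cvg_cst _).
exact: (@scale_continuous _ _ (0, v i)).
Qed.

(** Induction on [n]: the set for [n.+1] is the image of a product of two compact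
    sets under [(a, y) |-> a *: v ord0 + y]. *)
Lemma compact_lincomb {L n} (v : 'I_n -> L) (C : 'I_n -> set K^o) :
  (forall i, compact (C i)) ->
  compact [set \sum_(i < n) c i *: v i | c in [set c | forall i, C i (c i)]].
Proof.
elim: n v C => [|n IHn] v C cC.
  rewrite (_ : image _ _ = [set 0]); first exact: compact_set1.
  apply/seteqP; split=> [_ [c _ <-]|_ ->] /=; first by rewrite big_ord0.
  by exists (fun=> 0) => [[]|]; rewrite ?big_ord0.
pose S := [set \sum_(i < n) c i *: v (lift ord0 i) |
  c in [set c | forall i, C (lift ord0 i) (c i)]].
rewrite (_ : image _ _ =
    (fun z : K^o * L => z.1 *: v ord0 + z.2) @` (C ord0 `*` S)); last first.
  apply/seteqP; split=> [_ [c Cc <-]|_ [[a _] /= [Ca [c Cc <-]] <-]].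
    exists (c ord0, \sum_(i < n) c (lift ord0 i) *: v (lift ord0 i)).
      by split; [exact: Cc|exists (fun i => c (lift ord0 i))].
    by rewrite big_ord_recl.
  exists (fun i => if unlift ord0 i is Some j then c j else a).
    by move=> i /=; case: unliftP => [j|] ->; [exact: Cc|].
  rewrite big_ord_recl unlift_none; congr (_ + _).
  by apply: eq_bigr => j _; rewrite liftK.
apply: continuous_compact; last first.
  by apply: compact_setX; [exact: cC|
    exact: (IHn (fun i => v (lift ord0 i)) _ (fun i => cC (lift ord0 i)))].
apply: continuous_subspaceT => z.
apply: continuous2_cvg; [exact: (@add_continuous _ (_, _))| |exact: cvg_snd].
apply: continuous2_cvg; [|exact: cvg_fst|exact: cvg_cst].
exact: (@scale_continuous _ _ (_, _)).
Qed.

End LinearCombinations.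

(** * Continuity of coordinates in finite dimension *)

Section FiniteRank.
Context {K : numFieldType}.
Implicit Types E L : tvsType K.

Definition lincomb_free {L n} (v : 'I_n -> L) :=
  forall c : 'I_n -> K, \sum_(i < n) c i *: v i = 0 -> forall i, c i = 0.

(** [S i] below collects the combinations whose [i]-th coordinate is 1 and whose
    other coordinates lie in the (closed) unit ball: it is compact, hence
    closed, and misses 0 by freeness.  If a vector close to 0 had a large
    coordinate, dividing it by its largest coordinate [c m] would give a
    point of [S m] close to 0. *)
Lemma coord_bounded {L n} {v : 'I_n -> L} :
  precompact [set a : K^o | `|a| <= 1] -> hausdorff_space L ->
  lincomb_free v ->
  exists2 M : K, 0 < M &
    \forall x \near (0 : L), forall c : 'I_n -> K,
      x = \sum_(i < n) c i *: v i -> forall i, `|c i| <= M.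
Proof.
rewrite precompactE; set B := closure _ => cB hL fv.
have BP a : `|a| <= 1 -> B a by move=> ?; exact: subset_closure.
pose C (i j : 'I_n) : set K^o := if j == i then [set 1] else B.
pose S i := [set \sum_(j < n) c j *: v j | c in [set c | forall j, C i j (c j)]].
have cS i : closed (S i).
  apply: (compact_closed hL); apply: compact_lincomb => j.
  by rewrite /C; case: ifP => _ //; exact: compact_set1.
have S0 i : ~ S i 0.
  move=> [c Cc /fv/(_ i) ci0]; have := Cc i.
  by rewrite /C eqxx ci0 => /esym/eqP; rewrite oner_eq0.
have : \forall x \near (0 : L), forall i, ~ S i x.
  apply: filter_forall => i; apply: open_nbhs_nbhs.
  by split; [exact: closed_openC|exact: S0].
move=> /(nbhs0_absorb 0)[M M0 hM]; exists M => //.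
apply: filterS hM => x hx c xE i.
have [m _ maxm] := @real_arg_maxP K _ i predT (fun j => `|c j|) isT
  (fun j _ => normr_real (c j)).
apply: le_trans (maxm i isT) _.
have [//|cm] := real_leP (normr_real (c m)) (gtr0_real M0).
have cm0 : 0 < `|c m| by exact: lt_trans cm.
have cm0' : c m != 0 by rewrite -normr_gt0.
case: (hx (c m) (ltW cm) m); exists (fun j => (c m)^-1 * c j).
  move=> j; rewrite /C; case: eqP => [->|_] /=; first by rewrite mulVf.
  by apply: BP; rewrite normrM normfV mulrC ler_pdivrMr// mul1r; exact: maxm.
by rewrite xE scaler_sumr; apply: eq_bigr => j _; rewrite scalerA.
Qed.

(** A nontrivial relation between the [v i] lets one of them be eliminated, so the
    claim follows by induction on the number of spanning vectors. *)
Lemma finite_range_free {E L} {T : E -> L} : finite_dimensional_range T ->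
  exists n (v : 'I_n -> L), lincomb_free v /\
    forall x, exists c : 'I_n -> K, T x = \sum_(i < n) c i *: v i.
Proof.
move=> [n]; elim: n => [|n IHn] [v Tv].
  by exists 0%N, v; split=> // c _ [].
have [fv|] := pselect (lincomb_free v); first by exists n.+1, v.
move=> /existsNP[a /not_implyP[av0 /existsNP[i /eqP ai0]]].
apply: IHn; exists (fun j => v (lift i j)) => x; have [c ->] := Tv x.
exists (fun j => c (lift i j) - c i / a i * a (lift i j)).
rewrite (bigD1_ord i) //=; move: av0; rewrite (bigD1_ord i) //= => /eqP.
rewrite addr_eq0 => /eqP av.
have -> : v i = - ((a i)^-1 *: \sum_(j < n) a (lift i j) *: v (lift i j)).
  by rewrite -scalerN -av scalerA mulVf// scale1r.
rewrite scalerN scalerA addrC scaler_sumr -sumrB.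
by apply: eq_bigr => j _; rewrite scalerA -scalerBl.
Qed.

Lemma bounded_near_functional_continuous {E} {f : E -> K^o} {M : K} :
  linear f -> 0 < M -> (\forall x \near (0 : E), `|f x| <= M) -> continuous f.
Proof.
move=> lf M0 fM x; apply/cvgrPdist_lt => e e0.
have f0 : f 0 = 0 by have := lf (-1) 0 0; rewrite scaler0 addr0 scaleN1r addNr.
(* The factor 2 makes the final inequality strict, as M is only a weak bound. *)
have d0 : e / (2 * M) != 0 by rewrite gt_eqF// divr_gt0// mulr_gt0.
have := nbhsB x (nbhs0Z d0 fM); rewrite addr0; apply: filterS.
move=> _ [_ [y /= fy <-] <-].
have -> : x + e / (2 * M) *: y = e / (2 * M) *: y + x by rewrite addrC.
rewrite lf opprD addrCA subrr addr0 normrN normrM gtr0_norm; last first.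
  by rewrite divr_gt0// mulr_gt0.
apply: (@le_lt_trans _ _ (e / (2 * M) * M)).
  by rewrite ler_pM2l// divr_gt0// mulr_gt0.
rewrite invfM mulrA -mulrA mulVf ?gt_eqF// mulr1.
by rewrite ltr_pdivrMr// ltr_pMr// ltr1n.
Qed.

(** Linearity of the coordinates comes from uniqueness of the expansion, their
    continuity from [coord_bounded] transported to [E] through [T]. *)
Lemma finite_rank_decomposition {E L} {T : {linear E -> L}} :
  precompact [set a : K^o | `|a| <= 1] -> hausdorff_space L ->
  finite_dimensional_range T -> continuous T ->
  exists n (v : 'I_n -> L) (f : 'I_n -> tvs_dual E),
    forall x, T x = \sum_(i < n) f i x *: v i.
Proof.
move=> cptK hL /finite_range_free[n [v [fv /choice[c Tc]]]] cT.
have [M M0 hM] := coord_bounded cptK hL fv.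
have lc i : linear (fun x => c x i : K^o).
  move=> a x y; apply/eqP; rewrite -subr_eq0; apply/eqP.
  apply: (fv (fun j => c (a *: x + y) j - (a * c x j + c y j))).
  under eq_bigr do rewrite scalerBl scalerDl -scalerA.
  by rewrite sumrB big_split/= -scaler_sumr -!Tc linearP subrr.
have cc i : continuous (fun x => c x i : K^o).
  apply: (bounded_near_functional_continuous (lc i) M0).
  have := cT 0; rewrite /continuous_at linear0 => /(_ _ hM).
  apply: (@filterS _ (nbhs (0 : E))) => x /= h.
  exact: h (Tc x) i.
have cP i : (fun x => c x i : K^o) \in @dual_pred K E by apply/asboolP.
by exists n, v, (fun i => Dual (cP i)).
Qed.

End FiniteRank.

(** * Null sequences of scalars and of functionals *)

Lemma in_ellp_cvg0 (R : realType) (k : scalar_kind) (p : \bar R)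
    (x : nat -> (scalar_field R k)^o) :
  (1 <= p)%E -> in_ellp p x -> x @ \oo --> (0 : (scalar_field R k)^o).
Proof.
case: p => [r| |//] //; rewrite lee_fin => r1 /= xr.
have r0 : 0 < r by apply: lt_le_trans r1.
have := nnseries_is_cvg (fun n => powR_ge0 (modulus (x n)) r) xr.
move=> /cvg_series_cvg_0 /cvgr0_norm_lt xr0.
apply/cvgr0Pnorm_lt => e e0.
have eE : e = of_real k (modulus e) by rewrite -norm_modulus gtr0_norm.
have me0 : 0 < modulus e.
  rewrite lt_neqAle modulus_ge0 andbT eq_sym; apply: contraTneq e0.
  by move=> /modulus0_eq0 ->; rewrite ltxx.
have := xr0 _ (powR_gt0 r me0); apply: filterS => n.
rewrite ger0_norm ?powR_ge0// norm_modulus {2}eE => xe.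
rewrite lt_neqAle of_real_le.
have xe' : modulus (x n) < modulus e.
  rewrite ltNge; apply/negP => /(ge0_ler_powR (ltW r0)).
  by rewrite !nnegrE !modulus_ge0 => /(_ isT isT); rewrite leNgt xe.
rewrite (ltW xe') andbT; apply: contra_ltN xe' => /eqP/of_real_inj ->.
exact: lexx.
Qed.

Section NullSequences.
Context {K : numFieldType}.
Implicit Types L : tvsType K.

(** The topology of the strong dual is uniform on bounded sets, in particular on
    points. *)
Lemma strong_dual_eval_continuous L (y : L) :
  continuous (fun g : strong_dual L => g y : K^o).
Proof.
move=> f.
apply/(@cvgrPdist_lt _ K^o _ _ (@nbhs_filter (strong_dual L) f)) => e e0.
apply: (@filterS (strong_dual L) (nbhs f) _ _ _ _
  (strong_dual_nbhs f (tvs_bounded1 y) e0)).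
by move=> g; apply.
Qed.

Lemma weak_null_weak_star_null L (eta : nat -> strong_dual L) :
  weak_null eta -> weak_star_null (eta : nat -> tvs_dual L).
Proof.
move=> /weak_nullP eta0; apply/weak_star_nullP => y.
have lev : (fun g : strong_dual L => g y : K^o) \in
    @dual_pred K (strong_dual L).
  by apply/asboolP; split; [|exact: strong_dual_eval_continuous].
exact: (eta0 (Dual lev)).
Qed.

Lemma equicontinuous_null_cvg L (eta : nat -> tvs_dual L) (y : nat -> L) :
  equicontinuous [set: nat] (fun n => eta n : L -> K^o) ->
  y @ \oo --> (0 : L) -> eta n (y n) @[n --> \oo] --> (0 : K^o).
Proof.
move=> eqc y0; apply/cvgr0Pnorm_lt => e e0.
have ent : entourage [set xy : K^o * K^o | ball xy.1 e xy.2].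
  by rewrite -entourage_ballE; exists e.
have := y0 _ (eqc 0 _ ent); apply: (@filterS _ \oo) => n /= /(_ n I).
by rewrite -ball_normE /= dual0 sub0r normrN.
Qed.

End NullSequences.

(** * Operators between locally convex spaces *)

Lemma finite_rank_properties (R : realType) (k : scalar_kind)
    (p : \bar R) (p1 : (1 <= p)%E) (E L : tvsType (scalar_field R k))
    (T : {linear E -> L}) :
  hausdorff_space L -> finite_dimensional_range T -> continuous T ->
  [/\ p_convergent p T, coarse_p_limited p1 T & weak_star_p_convergent p T].
Proof.
move=> hL fT cT.
have cptK := scalar_unit_ball_precompact R k.
have [n [v [f Tf]]] := finite_rank_decomposition cptK hL fT cT.
have fx0 x i : weakly_summable p x ->
    f i (x m) @[m --> \oo] --> (0 : (scalar_field R k)^o).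
  by move=> /(_ (f i)); exact: in_ellp_cvg0.
split.
- move=> x xp; under eq_cvg do rewrite Tf.
  by apply: (cvg_lincomb v (fun i m => f i (x m))) => i; exact: fx0.
- (* The neighborhood depends on T alone, as the order of quantifiers requires. *)
  exists [set x | forall i, `|f i x| <= 1].
    apply: filter_forall => i.
    have := @dual_continuous _ _ (f i) 0; rewrite /continuous_at dual0.
    by move=> /cvgr0_norm_le/(_ 1 ltr01).
  split; first by exists (T 0), 0 => //= i; rewrite dual0 normr0 ler01.
  move=> S _; move: cptK; rewrite precompactE; set B := closure _ => cB.
  apply: (@precompact_subset (ellp k p1) _ [set \sum_(i < n) c i *: S (v i) |
    c in [set c : 'I_n -> (scalar_field R k)^o | forall i, B (c i)]]).
    move=> _ [_ [x /= fx1 <-] <-]; exists (fun i => f i x).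
      by move=> i /=; apply: subset_closure; exact: fx1.
    by rewrite Tf linear_sum; apply: eq_bigr => i _; rewrite linearZ.
  apply: compact_precompact; first exact: norm_hausdorff.
  exact: (@compact_lincomb _ (ellp k p1) n (fun i => S (v i)) (fun=> B)
    (fun=> cB)).
- move=> eta x /weak_star_nullP eta0 xp.
  (* The factor 1 presents this scalar sum as a linear combination in K. *)
  have -> : (fun m => eta m (T (x m))) = (fun m => \sum_(i < n)
      (f i (x m) * eta m (v i)) *: (1 : (scalar_field R k)^o)).
    apply/funext => m; rewrite Tf.
    have lin := dual_linear (eta m).
    elim/big_ind2 : _ => [|y a z b <- <-|i _]; first by rewrite dual0.
      by have := lin 1 a b; rewrite !scale1r.
    have := lin (f i (x m)) (v i) 0; rewrite dual0 !addr0 => ->.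
    by rewrite [RHS]mulr1.
  apply: (@cvg_lincomb _ nat \oo _ (scalar_field R k)^o n (fun=> 1)
    (fun i m => f i (x m) * eta m (v i))) => i.
  rewrite -[0 in X in _ --> X](mulr0 0).
  by apply: cvgM; [exact: fx0|exact: eta0].
Qed.

Theorem proposition3p1 (R : realType) (k : scalar_kind)
    (p : \bar R) (p1 : (1 <= p)%E)
    (E L : tvsType (scalar_field R k))
    (hE : hausdorff_space E) (hL : hausdorff_space L)
    (T : {linear E -> L}) :
  [/\ finite_dimensional_range T -> continuous T ->
        [/\ p_convergent p T, coarse_p_limited p1 T
          & weak_star_p_convergent p T],
      (weak_star_p_convergent p T -> weakly_p_convergent p T) /\
      (grothendieck L -> weakly_p_convergent p T -> weak_star_p_convergent p T),
      infty_quasibarrelled L -> p_convergent p T -> weakly_p_convergent p T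
    & c0_barrelled L -> p_convergent p T -> weak_star_p_convergent p T].
Proof.
split.
- exact: finite_rank_properties.
- split=> [wT eta x /weak_null_weak_star_null eta0 xp|gL wT eta x eta0 xp].
    exact: wT eta0 xp.
  by apply: (wT eta x _ xp); exact: gL eta0.
- by move=> qL pT eta x /qL eqc /pT Tx0; exact: equicontinuous_null_cvg eqc Tx0.
- by move=> bL pT eta x /bL eqc /pT Tx0; exact: equicontinuous_null_cvg eqc Tx0.
Qed.
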